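(* For every rooted tree $T$ and every path $P$, the graph $G_{T,P}$ has queue number at most $3$.
   Context: Graphs are finite, simple and undirected. For a rooted tree $T$ and a path $P$ with vertex set $\{1,2,\dots,m\}$ (edges $i\sim i+1$), $G_{T,P}$ is the graph with vertex set $V(T)\times\{1,\dots,m\}$ and three types of edges: vertical edges $(v,i)\sim(p,i)$ where $p$ is the parent of $v$ in $T$ and $1\le i\le m$; diagonal edges $(v,i)\sim(p,i+1)$ where $p$ is the parent of $v$ in $T$ and $1\le i\le m-1$; horizontal edges $(v,i)\sim(v,i+1)$ where $v\in V(T)$ and $1\le i\le m-1$. Let $L$ be a linear order on $V(G)$. Two edges with no common endpoint, written as $(a,b)$, $(c,d)$ with $a<b$ and $c<d$ in $L$, nest if $a<c<d<b$ or $c<a<b<d$; edges sharing an endpoint do not nest. A $k$-queue layout of $G$ is a pair $(L,\phi)$ where $L$ is a total order on $V(G)$ and $\phi$ is a colouring of $E(G)$ with $k$ colours (not necessarily proper) such that no two edges of the same colour nest with respect to $L$. The queue number of $G$ is the smallest integer $k$ such that $G$ admits a $k$-queue layout. *)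

(* Defs.v *)
From mathcomp Require Import all_boot boolp.

Set Implicit Arguments.
Unset Strict Implicit.
Unset Printing Implicit Defensive.

Record sgraph := SGraph {
  svertex :> finType;
  adj : rel svertex;
  adj_sym : symmetric adj;
  adj_irrefl : irreflexive adj }.

Definition edge_set (G : sgraph) : {set {set G}} :=
  [set e : {set G} | [exists x : G, exists y : G, adj x y && (e == [set x; y])]].

Definition edge (G : sgraph) := {e : {set G} | e \in edge_set G}.

(* A simple cycle is a [ucycle] with at least three vertices: for an edge xy,
   [:: x; y] is also a [ucycle]. *)
Definition is_tree (G : sgraph) : Prop :=
  [/\ inhabited G,
      forall x y : G, connect (@adj G) x y
    & forall c : seq G, ucycle (@adj G) c -> size c <= 2].

(* [parent r p v] : p is the first vertex after v on the path from v to the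
   root r.  In particular r has no parent. *)
Definition parent (T : sgraph) (r p v : T) : bool :=
  `[< exists s : seq T,
        [/\ path (@adj T) v (p :: s), uniq [:: v, p & s] & last p s = r] >].

(* The path on m vertices is represented by 'I_m, so that its vertices are
   numbered from 0 instead of 1. *)
Section GTP.
Variables (T : sgraph) (r : T) (m : nat).

Definition vertical (x y : T * 'I_m) : bool :=
  parent r y.1 x.1 && (y.2 == x.2).

Definition diagonal (x y : T * 'I_m) : bool :=
  parent r y.1 x.1 && (y.2 == x.2.+1 :> nat).

Definition horizontal (x y : T * 'I_m) : bool :=
  (y.1 == x.1) && (y.2 == x.2.+1 :> nat).

Definition GTP_arc (x y : T * 'I_m) : bool :=
  [|| vertical x y, diagonal x y | horizontal x y].

Definition GTP_adj : rel (T * 'I_m) :=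
  fun x y => GTP_arc x y || GTP_arc y x.

Lemma GTP_adj_sym : symmetric GTP_adj.
Proof. by move=> x y; rewrite /GTP_adj orbC. Qed.

Lemma parent_irrefl (v : T) : parent r v v = false.
Proof. by apply/asboolP => -[s [_ /=]]; rewrite inE eqxx. Qed.

Lemma GTP_adj_irrefl : irreflexive GTP_adj.
Proof.
move=> x; rewrite /GTP_adj /GTP_arc /vertical /diagonal /horizontal.
by rewrite parent_irrefl (ltn_eqF (ltnSn x.2)) !andbF.
Qed.

Definition GTP : sgraph := SGraph GTP_adj_sym GTP_adj_irrefl.

End GTP.

Section Queue.
Variable G : sgraph.

Definition linear_order (L : rel G) : Prop :=
  [/\ total L, antisymmetric L & transitive L].

Definition strict (L : rel G) : rel G := fun x y => (x != y) && L x y.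

(* The edge f = cd lies strictly inside the edge e = ab. *)
Definition nested_in (L : rel G) (f e : {set G}) : Prop :=
  exists a b c d : G,
    [/\ e = [set a; b], f = [set c; d],
        strict L a c, strict L c d & strict L d b].

Definition nest (L : rel G) (e f : {set G}) : Prop :=
  nested_in L f e \/ nested_in L e f.

Definition queue_layout (k : nat) (L : rel G) (phi : edge G -> 'I_k) : Prop :=
  linear_order L /\
  forall e f : edge G, phi e = phi f -> ~ nest L (val e) (val f).

Definition has_queue_layout (k : nat) : Prop :=
  exists (L : rel G) (phi : edge G -> 'I_k), queue_layout L phi.

Lemma nested_in_irrefl (L : rel G) (e : {set G}) :
  linear_order L -> ~ nested_in L e e.
Proof.
move=> [_ anti tr] [a [b [c [d [-> E /andP[ac Lac] /andP[cd Lcd] /andP[db Ldb]]]]]].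
have : a \in [set c; d] by rewrite -E set21.
rewrite !inE (negPf ac) /= => /eqP ad; subst d.
by move/eqP: ac; apply; apply: anti; rewrite Lac Lcd.
Qed.

Lemma ex_queue_layout : exists k, `[< has_queue_layout k >].
Proof.
exists #|{: edge G}|; apply/asboolP.
have linL : linear_order (fun x y : G => enum_rank x <= enum_rank y).
  split=> [x y|x y xy|y x z]; [exact: leq_total | | exact: leq_trans].
  by apply: enum_rank_inj; apply: val_inj; apply: anti_leq.
exists (fun x y => enum_rank x <= enum_rank y), enum_rank; split=> // e f.
by move/enum_rank_inj => <- [] /(nested_in_irrefl linL).
Qed.

Definition queue_number : nat := ex_minn ex_queue_layout.

End Queue.

(* Main.v *)
Require Import Defs.
From mathcomp Require Import all_boot.
From mathcomp Require Import boolp zify.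

Set Implicit Arguments.
Unset Strict Implicit.
Unset Printing Implicit Defensive.

(** Order the vertices layer by layer: [(v, i)] comes before [(w, j)] when
    [i < j], or when [i = j] and [v] comes before [w] in a breadth-first order
    of the tree, and give each of the three types of edges its own colour.

    A vertical edge stays inside one layer, where it is a tree edge.  A
    horizontal or diagonal edge goes from layer [i] to layer [i + 1].  Hence
    two nested edges of the same type use the same layers.  In a breadth-first
    order parents come before children and [v < w] implies
    [parent v <= parent w].  This excludes nested vertical edges, and it also
    excludes nested diagonal edges: [(v, i) < (w, i)] forces
    [(parent v, i + 1) <= (parent w, i + 1)].  For horizontal edges the
    corresponding map is the identity.

    The breadth-first order is given by numbers ([bfs_code]): with [N] larger
    than the number of vertices, the path from the root to [v] is read as a
    numeral in base [N] whose digits are the nonzero ranks of its vertices.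
    Dividing the code of a vertex by [N] gives the code of its parent
    ([bfs_code_parent]), so the map from codes to parent codes is monotone.
    This uses that paths of a tree are unique ([tree_path_unique]). *)

(** * Queue layouts from oriented edge classes *)

Section ArcLayout.
Variables (G : sgraph) (L : rel G).

(** Nesting of two edges oriented along the order is a condition on their tails
    and a condition on their heads; naming the ends of an unordered edge in
    increasing order is possible in only one way. *)
Lemma nested_in_arcs (x y z t : G) :
    linear_order L -> strict L x y -> strict L z t ->
    nested_in L [set z; t] [set x; y] ->
  strict L x z /\ strict L t y.
Proof.
move=> [_ anti tr].
have santi u w : strict L u w -> strict L w u -> False.
  move=> /andP[/eqP uw Luw] /andP[_ Lwu]; apply: uw.
  by apply: anti; rewrite Luw Lwu.
have strans u v w : strict L u v -> strict L v w -> strict L u w.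
  move=> suv svw; apply/andP; split; last first.
    by apply: tr (proj2 (andP suv)) (proj2 (andP svw)).
  by apply/eqP => uw; subst w; apply: santi suv svw.
have ends u w a b : strict L u w -> strict L a b ->
    [set u; w] = [set a; b] -> a = u /\ b = w.
  move=> suw sab E.
  have : a \in [set u; w] by rewrite E set21.
  have : b \in [set u; w] by rewrite E set22.
  rewrite !inE => /orP[]/eqP Eb /orP[]/eqP Ea; subst a b => //.
  - by case: (santi _ _ sab).
  - by case: (santi _ _ sab suw).
  - by case: (santi _ _ sab).
move=> sxy szt [a [b [c [d [Exy Ezt ac cd db]]]]].
have [<- <-] := ends _ _ _ _ sxy (strans _ _ _ ac (strans _ _ _ cd db)) Exy.
by have [<- <-] := ends _ _ _ _ szt cd Ezt.
Qed.

(** Colouring each edge by a class that contains it, in its forward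
    orientation, reduces a queue layout to conditions on arcs. *)
Lemma has_queue_layout_arcs (k : nat) (A : 'I_k -> rel G) :
    linear_order L ->
    (forall x y, adj x y -> exists c, A c x y || A c y x) ->
    (forall c x y, A c x y -> strict L x y) ->
    (forall c x y z t, A c x y -> A c z t -> strict L x z -> ~~ strict L t y) ->
  has_queue_layout G k.
Proof.
move=> linL cover fwd nonest.
have colour (e : edge G) :
    exists c, exists x y : G, A c x y /\ val e = [set x; y].
  case: e => e /=; rewrite inE => /existsP[x /existsP[y /andP[xy /eqP->]]].
  have [c /orP[Ac|Ac]] := cover _ _ xy; exists c; first by exists x, y.
  by exists y, x; rewrite setUC.
have [phi phiP] := choice colour.
exists L, phi; split=> // e f.
have nonest_in e' f' : phi e' = phi f' -> ~ nested_in L (val f') (val e').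
  move=> Ephi; have [x [y [Axy ->]]] := phiP e'.
  have [z [t [Azt ->]]] := phiP f'; rewrite -Ephi in Azt.
  case/(nested_in_arcs linL (fwd _ _ _ Axy) (fwd _ _ _ Azt)) => xz.
  exact/negP/(nonest _ _ _ _ _ Axy Azt xz).
by move=> Ephi []; apply: nonest_in.
Qed.

End ArcLayout.

Lemma queue_number_le (G : sgraph) (k : nat) :
  has_queue_layout G k -> queue_number G <= k.
Proof.
by move=> Gk; rewrite /queue_number; case: ex_minnP => n _; apply; apply/asboolP.
Qed.

(** * Paths in trees *)

Section Tree.
Variable T : sgraph.
Hypothesis treeT : is_tree T.

(** With different first steps, the two paths would close up, at the first
    vertex [z] of [s] that lies on [t], to a cycle. *)
Lemma tree_path_head (v : T) (s t : seq T) :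
    path (@adj T) v s -> uniq (v :: s) -> path (@adj T) v t -> uniq (v :: t) ->
    has (mem t) s ->
  ohead s = ohead t.
Proof.
move=> ps us pt ut meet; apply/eqP/contraT; move: ps us pt ut.
case/split_find: meet => z s1 s2 /= zt s1t.
case/splitPr: zt s1t => t1 t2 s1t.
rewrite cat_rcons !cat_path /= !mem_cat !cat_uniq /=.
move=> /and3P[ps1 s1z _] /andP[vs /andP[us1 /andP[zs _]]].
move=> /and3P[pt1 t1z _] /andP[vt /andP[ut1 /andP[zt _]]] hd.
have [_ _ acyclic] := treeT.
have : ucycle (@adj T) (v :: s1 ++ z :: rev t1).
  apply/andP; split.
    rewrite /= rcons_cat cat_path ps1 rcons_cons /= s1z /=.
    have := rev_path (@adj T) v (rcons t1 z).
    rewrite last_rcons belast_rcons rev_cons => ->.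
    rewrite (eq_path (e' := @adj T)); last by move=> a b; rewrite adj_sym.
    by rewrite rcons_path pt1.
  move: vs vt zs zt; rewrite /= !mem_cat !inE !negb_or mem_rev.
  case/and3P=> -> -> _ /and3P[-> _ _] /andP[zs _] /andP[zt _].
  rewrite cat_uniq us1 /= negb_or mem_rev rev_uniq ut1 zs zt /= andbT.
  apply/hasPn => w; rewrite mem_rev => wt1; apply: contra s1t => /= ws1.
  by apply/hasP; exists w; rewrite //= mem_cat wt1.
move/acyclic; move: hd; rewrite /= size_cat /= size_rev.
(* The cycle has at least three vertices because s1 and t1 are not both
   empty: that would make z the first step of both paths. *)
case: s1 {ps1 s1z vs us1 zs s1t} => [|a s1];
  case: t1 {pt1 t1z vt ut1 zt} => [|b t1] //=; by rewrite ?eqxx //; lia.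
Qed.

Lemma tree_path_unique (v : T) (s t : seq T) :
    path (@adj T) v s -> uniq (v :: s) -> path (@adj T) v t -> uniq (v :: t) ->
    last v s = last v t ->
  s = t.
Proof.
elim: s v t => [|x s IHs] v [|y t] //.
- by move=> _ _ _ /andP[/negP vt _] /= Ev; case: vt; rewrite {1}Ev mem_last.
- by move=> _ /andP[/negP vs _] _ _ /= Ev; case: vs; rewrite -{1}Ev mem_last.
move=> ps us pt ut /= E.
have meet : has (mem (y :: t)) (x :: s).
  by apply/hasP; exists (last x s); rewrite ?mem_last //= E mem_last.
case: (tree_path_head ps us pt ut meet) => xy; subst y; congr (_ :: _).
case/andP: ps => _ ps; case/andP: us => _ us.
case/andP: pt => _ pt; case/andP: ut => _ ut.
exact: IHs ps us pt ut E.
Qed.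

Variable r : T.

Lemma ex_root_path (v : T) :
  exists s, [/\ path (@adj T) v s, uniq (v :: s) & last v s = r].
Proof.
have [_ conn _] := treeT; have /connectP[s ps ->] := conn v r.
by case/shortenP: ps => s' ps' us' _; exists s'.
Qed.

Definition root_path (v : T) : seq T := sval (cid (ex_root_path v)).

Lemma root_pathP (v : T) :
  [/\ path (@adj T) v (root_path v), uniq (v :: root_path v)
    & last v (root_path v) = r].
Proof. exact: svalP (cid (ex_root_path v)). Qed.

Lemma root_path_parent (p v : T) :
  parent r p v -> root_path v = p :: root_path p.
Proof.
move=> /asboolP[s [pvs uvs lps]]; have [ps us ls] := root_pathP v.
have [pp up lp] := root_pathP p.
rewrite (tree_path_unique ps us pvs uvs); last by rewrite ls /= lps.
case/andP: pvs => _ pps; case/andP: uvs => _ ups.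
by rewrite (tree_path_unique pps ups pp up) // lp.
Qed.

(** * A breadth-first order *)

(** Digits are nonzero and smaller than the base, so a code determines its head
    vertex and dividing by the base removes exactly that vertex. *)
Definition path_code (s : seq T) : nat :=
  foldr (fun x n => n * #|T|.+1 + (enum_rank x).+1) 0 s.

Definition bfs_code (v : T) : nat := path_code (v :: root_path v).

Lemma bfs_code_inj : injective bfs_code.
Proof.
move=> u v /(congr1 (modn^~ #|T|.+1)).
rewrite /bfs_code /= !modnMDl !modn_small ?ltnS ?ltn_ord // => -[] Euv.
exact/enum_rank_inj/val_inj.
Qed.

Lemma bfs_code_parent (p v : T) :
  parent r p v -> bfs_code v %/ #|T|.+1 = bfs_code p.
Proof.
move=> /root_path_parent Ev; rewrite /bfs_code Ev.
rewrite [path_code (v :: _)]/= divnMDl // divn_small ?addn0 //.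
by rewrite ltnS ltn_ord.
Qed.

Lemma bfs_code_parent_lt (p v : T) : parent r p v -> bfs_code p < bfs_code v.
Proof.
move=> pv; rewrite -(bfs_code_parent pv).
apply: ltn_Pdiv; last by rewrite /bfs_code /= addnS.
by rewrite ltnS; apply/card_gt0P; exists r.
Qed.

Lemma bfs_code_parent_mono (p v q w : T) :
    parent r p v -> parent r q w -> bfs_code v <= bfs_code w ->
  bfs_code p <= bfs_code q.
Proof.
by move=> /bfs_code_parent<- /bfs_code_parent<-; apply: leq_div2r.
Qed.

(** * The layered order *)

Variable m : nat.

Definition layer_le (x y : GTP r m) : bool :=
  (x.2 < y.2) || ((x.2 == y.2 :> nat) && (bfs_code x.1 <= bfs_code y.1)).

Lemma layer_le_linear : linear_order layer_le.
Proof.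
rewrite /layer_le; split=> [x y|x y xy|y x z]; [lia| |lia].
case: x y xy => [u i] [v j] /= uv; congr (_, _).
  by apply: bfs_code_inj; lia.
by apply: val_inj => /=; lia.
Qed.

Lemma strict_layer_le (x y : GTP r m) :
  strict layer_le x y =
  (x.2 < y.2) || ((x.2 == y.2 :> nat) && (bfs_code x.1 < bfs_code y.1)).
Proof.
rewrite /strict /layer_le; case: x y => [u i] [v j] /=.
rewrite xpair_eqE -(inj_eq bfs_code_inj) -(inj_eq val_inj) /=; lia.
Qed.

(** Each arc is listed from its earlier to its later end, so a vertical edge
    goes from the parent to the child and a diagonal edge the other way. *)
Definition layer_arc (c : 'I_3) (x y : GTP r m) : bool :=
  match val c with
  | 0 => vertical r y x
  | 1 => diagonal r x y
  | _ => horizontal x y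
  end.

Lemma layer_arc_cover (x y : GTP r m) :
  adj x y -> exists c, layer_arc c x y || layer_arc c y x.
Proof.
by case/orP=> /or3P[] xy;
   [exists (@Ordinal 3 0 isT) | exists (@Ordinal 3 1 isT)
   |exists (@Ordinal 3 2 isT) | exists (@Ordinal 3 0 isT)
   |exists (@Ordinal 3 1 isT) | exists (@Ordinal 3 2 isT)];
   rewrite /layer_arc /= xy ?orbT.
Qed.

Lemma layer_arc_forward (c : 'I_3) (x y : GTP r m) :
  layer_arc c x y -> strict layer_le x y.
Proof.
rewrite strict_layer_le; case: c => [[|[|c]] ltc] /andP[] /=; try lia.
by move=> /bfs_code_parent_lt -> /eqP->; rewrite eqxx orbT.
Qed.

(** For one type of edge, the later ends are in the same weak order as the
    earlier ends; for vertical edges this is the contrapositive of monotonicity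
    of the parent map. *)
Lemma layer_arc_nonnesting (c : 'I_3) (x y z t : GTP r m) :
    layer_arc c x y -> layer_arc c z t -> strict layer_le x z ->
  ~~ strict layer_le t y.
Proof.
rewrite !strict_layer_le.
case: c => [[|[|c]] ltc] /andP[xy1 /eqP xy2] /andP[zt1 /eqP zt2] /=.
- have := @bfs_code_parent_mono _ _ _ _ zt1 xy1; rewrite xy2 zt2; lia.
- have := @bfs_code_parent_mono _ _ _ _ xy1 zt1; lia.
- by rewrite (eqP xy1) (eqP zt1); lia.
Qed.

End Tree.

Theorem proposition7p1 (T : sgraph) (r : T) (m : nat)
  (hT : is_tree T) (hm : 0 < m) :
  queue_number (GTP r m) <= 3.
Proof.
apply/queue_number_le/(has_queue_layout_arcs (layer_le_linear hT r m)).
- exact: layer_arc_cover.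
- exact: layer_arc_forward.
- exact: layer_arc_nonnesting.
Qed.
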